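(* Let $\ell\ge r\ge2$ and let $\mathcal{H}$ be a $\mathcal{K}_{\ell+1}^r$-free $r$-graph. Then for every integer $i$ with $r-\ell\le i\le r-2$, \[ \left(\frac{|\partial_i\mathcal{H}|}{\binom{\ell}{r-i}}\right)^{\frac{1}{r-i}}\le\left(\frac{|\partial_{i+1}\mathcal{H}|}{\binom{\ell}{r-i-1}}\right)^{\frac{1}{r-i-1}}; \] that is, \[ \left(\frac{|\partial_{r-\ell}\mathcal{H}|}{\binom{\ell}{\ell}}\right)^{\frac1\ell}\le\cdots\le\left(\frac{|\partial_{-1}\mathcal{H}|}{\binom{\ell}{r+1}}\right)^{\frac{1}{r+1}}\le\left(\frac{|\mathcal{H}|}{\binom{\ell}{r}}\right)^{\frac1r}\le\left(\frac{|\partial_1\mathcal{H}|}{\binom{\ell}{r-1}}\right)^{\frac{1}{r-1}}\le\cdots\le\left(\frac{|\partial_{r-1}\mathcal{H}|}{\binom{\ell}{1}}\right)^{\frac11}. \]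
   Context: An $r$-graph $\mathcal{H}$ is a finite vertex set $V(\mathcal{H})$ together with a set of $r$-element subsets (edges). $\mathcal{H}$ is $\mathcal{F}$-free if it contains no member of the family $\mathcal{F}$ as a (not necessarily induced) subgraph. $\mathcal{K}_{\ell+1}^r$ is the collection of all $r$-graphs $F$ with at most $\binom{\ell+1}{2}$ edges such that for some $(\ell+1)$-set $S$ every pair $\{u,v\}\subset S$ is contained in some edge of $F$. For $1\le i\le r-1$, the $i$-th shadow is $\partial_i\mathcal{H}=\{A\in\binom{V(\mathcal{H})}{r-i}: A\subset B\text{ for some }B\in\mathcal{H}\}$; for $i\le0$, $\partial_i\mathcal{H}=\{A\in\binom{V(\mathcal{H})}{r-i}: \mathcal{H}[A]\text{ is a complete } r\text{-graph}\}$, where $\mathcal{H}[A]$ is the induced subgraph on $A$. In particular $\partial_0\mathcal{H}=\mathcal{H}$. *)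

(* Defs.v *)
From HB Require Import structures.
From mathcomp Require Import all_boot all_order all_algebra.
From mathcomp Require Import reals exp.

Set Implicit Arguments.
Unset Strict Implicit.
Unset Printing Implicit Defensive.

Import Order.TTheory GRing.Theory Num.Theory.

Record hgraph (r : nat) := HGraph {
  vertex : finType;
  edges : {set {set vertex}};
  edges_card : forall e : {set vertex}, e \in edges -> #|e| = r }.

(* Not necessarily induced copies of F in H. *)
Definition contains (r : nat) (H F : hgraph r) : Prop :=
  exists2 f : vertex F -> vertex H, injective f &
    forall e : {set vertex F}, e \in edges F -> f @: e \in edges H.

Definition free_of (r : nat) (FF : hgraph r -> Prop) (H : hgraph r) : Prop :=
  forall F : hgraph r, FF F -> ~ contains H F.

(* The family K_m^r; with m = l.+1 this is K_{l+1}^r. *)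
Definition Kfam (r m : nat) (F : hgraph r) : Prop :=
  #|edges F| <= 'C(m, 2) /\
  exists2 S : {set vertex F}, #|S| = m &
    forall u v : vertex F, u \in S -> v \in S -> u != v ->
      exists2 e : {set vertex F}, e \in edges F & [set u; v] \subset e.

Definition induced_edges (r : nat) (H : hgraph r) (A : {set vertex H}) :
  {set {set vertex H}} := [set e in edges H | e \subset A].

(* H[A] is a complete r-graph. *)
Definition induces_complete (r : nat) (H : hgraph r) (A : {set vertex H}) :
  bool :=
  induced_edges A == [set e : {set vertex H} | e \subset A & #|e| == r].

Definition shadow (r : nat) (H : hgraph r) (i : int) : {set {set vertex H}} :=
  [set A : {set vertex H} | (#|A|%:Z == r%:Z - i)%R &
    if (0 < i)%R then [exists B in edges H, A \subset B]
    else induces_complete A].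

(* Main.v *)
(* The edges, the sets contained in edges and the sets inducing complete subgraphs
   form a simplicial complex D whose 1-skeleton has no clique on l + 1 vertices.
   Give the vertices weights x >= 0 and let P_s(x) be the sum over the s-faces of
   the products of their weights; the claim
     (P_(n+1)(x) / 'C(l, n+1)) ^ n <= (P_n(x) / 'C(l, n)) ^ (n+1)
   at x = 1 is the theorem. If u and v are not joined, P_n and P_(n+1) are affine
   in (x u, x v), so moving along the line on which P_n is constant one can kill
   one of the two weights without decreasing P_(n+1). Hence the support of x may
   be assumed to be a clique, so to have at most l vertices, and then the claim
   holds for an arbitrary complex, by induction on n through vertex links as in
   Lovasz's proof of the Kruskal-Katona theorem. *)
Require Import Defs.
From HB Require Import structures.
From mathcomp Require Import all_boot all_order all_algebra.
From mathcomp Require Import ring lra zify.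
From mathcomp Require Import reals exp.

Set Implicit Arguments.
Unset Strict Implicit.
Unset Printing Implicit Defensive.

Import Order.TTheory GRing.Theory Num.Theory.
Local Open Scope ring_scope.

(** * Real inequalities for one vertex and for a pair of vertices *)

Lemma powR_invnK (R : realType) (a : R) n :
  (0 < n)%N -> 0 <= a -> (a `^ n%:R^-1) ^+ n = a.
Proof.
move=> n_gt0 a_ge0.
by rewrite -powR_mulrn ?powR_ge0 // -powRrM mulVf ?powRr1 // pnatr_eq0 -lt0n.
Qed.

Lemma bernoulli (R : realDomainType) (t : R) n : -1 <= t -> 1 + n%:R * t <= (1 + t) ^+ n.
Proof.
move=> t1; elim: n => [|n IH]; first by rewrite mul0r addr0 expr0.
have h : (1 + n%:R * t) * (1 + t) <= (1 + t) ^+ n.+1.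
  by rewrite exprSr ler_wpM2r // -lerBlDl sub0r.
apply: le_trans h; rewrite -natr1.
have := mulr_ge0 (ler0n R n) (sqr_ge0 t); nra.
Qed.

(* The per-vertex estimate: a tangent line, via Bernoulli, to the concave function
   y |-> y * (((k + n) * rho ^ n - n * y) / k) ^ (1 / n) at y = rho ^ n. *)
Lemma vertex_bound (R : realFieldType) (a d y rho : R) (k n : nat) :
  (0 < k)%N -> (0 < n)%N -> 0 < rho -> 0 <= a -> 0 <= y -> 0 <= d ->
  a ^+ n <= y ^+ n * d -> k%:R * d <= (k + n)%:R * rho ^+ n - n%:R * y ->
  a <= rho * (y + (rho ^+ n - y) / k%:R).
Proof.
move=> k0 n0 r0 a0 y0 d0 ad dy.
have K0 : 0 < k%:R :> R by rewrite ltr0n.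
have rn0 : 0 < rho ^+ n by rewrite exprn_gt0.
(* The tangent point is z = 1, t = 0. In terms of t the last hypothesis reads d <= rho^n (1 + n t),
   ready for Bernoulli. *)
pose z := y / rho ^+ n.
have yz : y = z * rho ^+ n by rewrite divfK ?gt_eqF.
pose t := (1 - z) / k%:R.
have tz : 1 - z = t * k%:R by rewrite divfK ?gt_eqF.
have dt : d <= rho ^+ n * (1 + n%:R * t).
  rewrite -(ler_pM2l K0); apply: le_trans dy _.
  rewrite yz natrD (_ : z = 1 - t * k%:R); last by rewrite -tz; ring.
  by rewrite le_eqVlt; apply/orP; left; apply/eqP; ring.
have nt0 : 0 <= 1 + n%:R * t.
  by rewrite -(pmulr_rge0 _ rn0); apply: le_trans dt.
have n1 : 1 <= n%:R :> R by rewrite ler1n.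
have t1 : -1 <= t by nra.
have y_le : a <= y * rho * (1 + t).
  rewrite -(@ler_pXn2r _ n) //; last first.
    by rewrite nnegrE !mulr_ge0 ?(ltW r0) //; lra.
  apply: le_trans ad _; rewrite !exprMn -!mulrA ler_wpM2l ?exprn_ge0 //.
  by apply: le_trans dt _; rewrite ler_wpM2l ?(ltW rn0) // bernoulli.
apply: le_trans y_le _.
rewrite -mulrA mulrCA ler_wpM2l ?(ltW r0) // mulrDr mulr1 lerD2l.
have -> : (rho ^+ n - y) / k%:R = rho ^+ n * t.
  by rewrite /t {1}yz; ring.
rewrite yz mulrAC mulrC ler_wpM2l ?(ltW rn0) //.
(* The goal is now z t <= t, and (1 - z) t = k t^2. *)
have : 0 <= k%:R * t ^+ 2 by rewrite mulr_ge0 ?sqr_ge0 ?(ltW K0).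
rewrite (_ : z = 1 - t * k%:R); last by rewrite -tz; ring.
by rewrite expr2; nra.
Qed.


(* A linear functional on a segment in the positive quadrant is maximal at an
   end of the segment. *)
Lemma two_point_shift (R : realFieldType) (a b p q p' q' : R) :
  0 <= a -> 0 <= b -> 0 <= p -> 0 <= q ->
  (p = 0 -> p' = 0) -> (q = 0 -> q' = 0) ->
  exists a' b', [/\ 0 <= a', 0 <= b', (a' == 0) || (b' == 0),
    a' * p + b' * q = a * p + b * q & a * p' + b * q' <= a' * p' + b' * q'].
Proof.
move=> a0 b0 p0 q0 pp' qq'.
have [pE|p_neq0] := eqVneq p 0.
  by exists 0, b; rewrite pE (pp' pE) !mulr0 !add0r eqxx; split.
have [qE|q_neq0] := eqVneq q 0.
  by exists a, 0; rewrite qE (qq' qE) !mulr0 !addr0 eqxx orbT; split.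
have p_gt0 : 0 < p by rewrite lt_neqAle eq_sym p_neq0.
have q_gt0 : 0 < q by rewrite lt_neqAle eq_sym q_neq0.
(* All the weight goes to the coordinate with the larger of the ratios p'/p and q'/q, scaled so as
   to preserve a p + b q. *)
have [h|/ltW h] := lerP (p * q') (q * p').
  exists (a + b * q / p), 0; rewrite eqxx orbT; split=> //.
  - by rewrite addr_ge0 // divr_ge0 // mulr_ge0.
  - by rewrite mul0r addr0 mulrDl divfK.
  rewrite mul0r addr0 mulrDl lerD2l -!mulrA ler_wpM2l //.
  by rewrite mulrCA ler_pdivlMl.
exists 0, (b + a * p / q); rewrite eqxx; split=> //.
- by rewrite addr_ge0 // divr_ge0 // mulr_ge0.
- by rewrite mul0r add0r mulrDl divfK // addrC.
rewrite mul0r add0r mulrDl addrC lerD2l -!mulrA ler_wpM2l //.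
by rewrite mulrCA ler_pdivlMl.
Qed.

Lemma subset_of_card (T : finType) (B : {set T}) k :
  (k <= #|B|)%N -> exists2 A : {set T}, A \subset B & #|A| = k.
Proof.
rewrite -bin_gt0 -cards_draws card_gt0 => /set0Pn[A].
by rewrite inE => /andP[AB /eqP cA]; exists A.
Qed.

(** * Simplicial complexes and their weighted face sums *)

Section Complexes.
Variable V : finType.
Implicit Types (D : {set {set V}}) (A B S : {set V}) (u v : V).

Definition down_closed D :=
  forall A B, B \in D -> A \subset B -> A \in D.

Definition link D v := [set A : {set V} | (v \notin A) && (v |: A \in D)].

Definition deletion D v := [set A : {set V} in D | v \notin A].

Lemma link_down_closed D v : down_closed D -> down_closed (link D v).
Proof.
move=> Ddown A B; rewrite !inE => /andP[vB vBD] sAB; apply/andP; split.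
  by apply: contra vB; apply: subsetP.
by apply: Ddown vBD _; apply: setUS.
Qed.

Lemma deletion_down_closed D v : down_closed D -> down_closed (deletion D v).
Proof.
move=> Ddown A B; rewrite !inE => /andP[BD vB] sAB; apply/andP; split.
  exact: Ddown BD sAB.
by apply: contra vB; apply: subsetP.
Qed.

Lemma link_subset_deletion D v :
  down_closed D -> link D v \subset deletion D v.
Proof.
move=> Ddown; apply/subsetP => A; rewrite !inE => /andP[-> vAD].
by rewrite andbT; apply: Ddown vAD _; apply: subsetUr.
Qed.

Variable R : realType.
Implicit Types x y : V -> R.

Definition face_sum D m x : R :=
  \sum_(A in D | #|A| == m) \prod_(v in A) x v.

Lemma face_sum_ge0 D m x : (forall v, 0 <= x v) -> 0 <= face_sum D m x.
Proof. by move=> x0; apply: sumr_ge0 => A _; apply: prodr_ge0. Qed.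

Lemma eq_face_sum D m x y :
  (forall A, A \in D -> {in A, x =1 y}) -> face_sum D m x = face_sum D m y.
Proof.
move=> exy; apply: eq_bigr => A /andP[AD _]; apply: eq_bigr => v vA.
exact: exy AD _ vA.
Qed.

Lemma face_sum0 D x : set0 \in D -> face_sum D 0 x = 1.
Proof.
move=> D0; rewrite /face_sum (big_pred1 set0) ?big_set0 // => A /=.
by rewrite cards_eq0; case: eqP => [->|_]; rewrite ?andbT ?andbF.
Qed.

Lemma le_face_sum D1 D2 m x : (forall v, 0 <= x v) ->
  D1 \subset D2 -> face_sum D1 m x <= face_sum D2 m x.
Proof.
move=> x0 /subsetP sD; rewrite /face_sum.
rewrite [leRHS](bigID [in D1]) /= ler_wpDr //.
  by apply: sumr_ge0 => A _; apply: prodr_ge0.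
rewrite le_eqVlt; apply/orP; left; apply/eqP; apply: eq_bigl => A.
case AD1: (A \in D1); rewrite ?andbF ?andbT //=.
by rewrite (sD _ AD1).
Qed.

Lemma face_sum_star D m x v :
  \sum_(A in D | (#|A| == m.+1) && (v \in A)) \prod_(w in A) x w =
  x v * face_sum (link D v) m x.
Proof.
rewrite /face_sum big_distrr /=.
rewrite (reindex_onto (fun A => v |: A) (fun A => A :\ v)) /=; last first.
  by move=> A /and3P[_ _ vA]; apply: setD1K.
apply: eq_big => [A|A].
  rewrite !inE eqxx andbT cardsU1.
  have [vA|vA] := boolP (v \in A).
    case: (_ =P A) => [defA|]; last by rewrite andbF.
    by move: vA; rewrite -defA !inE eqxx.
  by rewrite setU1K // eqxx andbT add1n eqSS.
case/andP=> _ /eqP defA; rewrite big_setU1 //.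
by rewrite -defA !inE eqxx.
Qed.

Lemma face_sum_split D m x v :
  face_sum D m.+1 x =
  x v * face_sum (link D v) m x + face_sum (deletion D v) m.+1 x.
Proof.
rewrite -face_sum_star /face_sum (bigID (fun A => v \in A)) /=.
congr (_ + _); apply: eq_bigl => A; rewrite ?inE; first by rewrite andbA.
by rewrite -!andbA; congr (_ && _); apply: andbC.
Qed.

(** Each face of size m + 1 is counted once for each of its vertices. This is Euler's identity for a
    homogeneous polynomial, the link sums being its partial derivatives. *)
Lemma face_sum_euler D m x :
  m.+1%:R * face_sum D m.+1 x = \sum_v x v * face_sum (link D v) m x.
Proof.
under eq_bigr do rewrite -face_sum_star.
rewrite (exchange_big_dep (fun A => (A \in D) && (#|A| == m.+1))) /=; last first.
  by move=> v A _ /and3P[-> ->].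
rewrite /face_sum big_distrr /=; apply: eq_bigr => A /andP[AD /eqP cA].
symmetry.
rewrite (eq_bigl [in A]) => [|v]; last by rewrite AD cA eqxx.
by rewrite sumr_const cA mulr_natl.
Qed.

(** Links are subcomplexes, so their degree m sums vanish too, and Euler's identity applies. *)
Lemma face_sum_eq0S D m x : down_closed D -> (forall v, 0 <= x v) ->
  face_sum D m x = 0 -> face_sum D m.+1 x = 0.
Proof.
move=> Ddown x0 P0; apply/eqP.
suff /eqP : m.+1%:R * face_sum D m.+1 x = 0 by rewrite mulf_eq0 pnatr_eq0.
rewrite face_sum_euler; apply: big1 => v _.
suff -> : face_sum (link D v) m x = 0 by rewrite mulr0.
apply/eqP; rewrite eq_le face_sum_ge0 // andbT -P0 le_face_sum //.
apply: subset_trans (link_subset_deletion v Ddown) _.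
by apply/subsetP => A; rewrite inE => /andP[].
Qed.

Lemma link_le_face_sum D m x v : down_closed D -> (forall v, 0 <= x v) ->
  face_sum (link D v) m.+1 x <=
  face_sum D m.+1 x - x v * face_sum (link D v) m x.
Proof.
move=> Ddown x0; rewrite [face_sum D _ _](face_sum_split D m x v) addrC addKr.
by rewrite le_face_sum // link_subset_deletion.
Qed.

Lemma face_sum_link_nonface D m x v :
  [set v] \notin D -> down_closed D -> face_sum (link D v) m x = 0.
Proof.
move=> vD Ddown; apply: big1 => A /andP[]; rewrite inE => /andP[_ vAD] _.
by move: vD; rewrite (Ddown _ _ vAD) // subsetUl.
Qed.

(* By Euler's identity both sides are averages over the vertices v of S of the
   face sums of the links. Faces of size n split into those avoiding v, among
   which are the faces of the link, and those containing v: this bounds the link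
   a second time, beside the induction hypothesis. *)
Lemma face_sum_bounded_support n : forall l D S x, (n < l)%N ->
  down_closed D -> set0 \in D -> (forall A, A \in D -> A \subset S) ->
  (#|S| <= l)%N -> (forall v, 0 <= x v) ->
  (face_sum D n.+1 x / 'C(l, n.+1)%:R) ^+ n <=
  (face_sum D n x / 'C(l, n)%:R) ^+ n.+1.
Proof.
elim: n => [|m IH] [|l] // D S x lm Ddown D0 DS cS x0.
  by rewrite expr0 expr1 face_sum0 // bin0 divr1.
have bin_gt0R a b : (b <= a)%N -> 0 < 'C(a, b)%:R :> R.
  by move=> ba; rewrite ltr0n bin_gt0.
set n := m.+1 in lm *.
set C := 'C(l.+1, n)%:R; set C' := 'C(l.+1, n.+1)%:R.
have C_gt0 : 0 < C by rewrite bin_gt0R // ltnW.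
have C'_gt0 : 0 < C' by rewrite bin_gt0R.
(* [S] has at most [l.+1] vertices here, and a link has one less: its face sums are normalized by
   binomials of [l]. *)
pose e0 : R := 'C(l, m)%:R; pose d0 : R := 'C(l, n)%:R.
have e0_gt0 : 0 < e0 by rewrite bin_gt0R // ltnW.
have d0_gt0 : 0 < d0 by rewrite bin_gt0R.
have e0C : l.+1%:R * e0 = n%:R * C by rewrite -!natrM -mul_bin_diag.
have d0C : l.+1%:R * d0 = n.+1%:R * C' by rewrite -!natrM -mul_bin_diag.
pose k := (l - m)%N; have k_gt0 : (0 < k)%N by rewrite subn_gt0.
have d0e0 : n%:R * d0 = k%:R * e0 by rewrite -!natrM -mul_bin_left.
have lE : l.+1 = (k + n)%N by rewrite addnS subnK // ltnW.
have l_gt0 : 0 < l.+1%:R :> R by rewrite ltr0n.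
have n_gt0 : 0 < n%:R :> R by rewrite ltr0n.
have K_gt0 : 0 < k%:R :> R by rewrite ltr0n.
have [P0|P_neq0] := eqVneq (face_sum D n x) 0.
  by rewrite (face_sum_eq0S Ddown x0 P0) P0 !mul0r !expr0n.
(* With this root the claim becomes P_(n+1) / C' <= rho^(n+1). *)
pose rho := (face_sum D n x / C) `^ n%:R^-1.
have P_ge0 : 0 <= face_sum D n x / C.
  by rewrite divr_ge0 ?face_sum_ge0 // ltW.
have rhon : rho ^+ n = face_sum D n x / C.
  exact: powR_invnK.
have rho_gt0 : 0 < rho.
  rewrite powR_gt0 // lt_neqAle P_ge0 andbT eq_sym.
  by rewrite mulf_neq0 ?invr_neq0 // gt_eqF.
have rhon_gt0 : 0 < rho ^+ n by rewrite exprn_gt0.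
pose y v := x v * (face_sum (link D v) m x / e0).
pose d v := face_sum (link D v) n x / d0.
have y_ge0 v : 0 <= y v.
  by rewrite mulr_ge0 // divr_ge0 ?face_sum_ge0 // ltW.
have d_ge0 v : 0 <= d v by rewrite divr_ge0 ?face_sum_ge0 // ltW.
have link_out v : v \notin S -> [set v] \notin D.
  by apply: contra => /DS; rewrite sub1set.
have sum_y : \sum_(v in S) y v = l.+1%:R * rho ^+ n.
  rewrite rhon -[LHS](mulfK (lt0r_neq0 e0_gt0)) big_distrl /=.
  have -> : \sum_(v in S) y v * e0 = n%:R * face_sum D n x.
    rewrite face_sum_euler [RHS](bigID [in S]) /= [X in _ = _ + X]big1 ?addr0.
      by apply: eq_bigr => v _; rewrite /y -mulrA divfK // gt_eqF.
    by move=> v vS; rewrite face_sum_link_nonface ?mulr0 // link_out.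
  rewrite [RHS]mulrA; apply/eqP; rewrite eqr_div ?lt0r_neq0 //.
  rewrite mulrAC -e0C; apply/eqP; ring.
have sum_d : \sum_(v in S) x v * d v = l.+1%:R * (face_sum D n.+1 x / C').
  rewrite -[LHS](mulfK (lt0r_neq0 d0_gt0)) big_distrl /=.
  have -> : \sum_(v in S) x v * d v * d0 = n.+1%:R * face_sum D n.+1 x.
    rewrite face_sum_euler [RHS](bigID [in S]) /= [X in _ = _ + X]big1 ?addr0.
      by apply: eq_bigr => v _; rewrite /d -mulrA divfK // gt_eqF.
    by move=> v vS; rewrite face_sum_link_nonface ?mulr0 // link_out.
  rewrite [RHS]mulrA; apply/eqP; rewrite eqr_div ?lt0r_neq0 //.
  rewrite mulrAC -d0C; apply/eqP; ring.
have vertexP v : v \in S -> x v * d v <= rho * (y v + (rho ^+ n - y v) / k%:R).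
  move=> vS; apply: (@vertex_bound _ _ (d v) _ _ _ n) => //.
  - by rewrite mulr_ge0.
  (* The induction hypothesis needs [set0] in the link, that is, v to be a face; otherwise the link
     is empty and d v = 0. *)
  - have [vD|vD] := boolP ([set v] \in D); last first.
      suff -> : d v = 0 by rewrite !mulr0 expr0n.
      by rewrite /d face_sum_link_nonface // mul0r.
    (* Split d^n as d^m d; the induction hypothesis in the link bounds d^m. *)
    rewrite exprMn [y v ^+ n]exprMn -[leRHS]mulrA ler_wpM2l ?exprn_ge0 //.
    rewrite [leLHS]exprSr.
    rewrite ler_wpM2r //; apply: (IH l _ (S :\ v)) => //.
    + exact: link_down_closed.
    + rewrite inE in_set0 /=.
      by rewrite setU0.
    + move=> A; rewrite inE => /andP[vA /DS].
      by rewrite subUset => /andP[_ AS]; rewrite subsetD1 AS.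
    + by move: cS; rewrite (cardsD1 v S) vS.
  - rewrite -lE rhon -(ler_pM2r d0_gt0) -mulrA divfK ?gt_eqF //.
    have -> : (l.+1%:R * (face_sum D n x / C) - n%:R * y v) * d0 =
        k%:R * (face_sum D n x - x v * face_sum (link D v) m x).
      have -> : face_sum (link D v) m x = face_sum (link D v) m x / e0 * e0.
        by rewrite divfK ?gt_eqF.
      rewrite mulrBl [n%:R * _ * _]mulrAC d0e0.
      have -> : l.+1%:R * (face_sum D n x / C) * d0 = k%:R * face_sum D n x.
        rewrite -{2}(divfK (lt0r_neq0 C_gt0) (face_sum D n x)).
        rewrite -[LHS](mulKf (lt0r_neq0 n_gt0)) -[RHS](mulKf (lt0r_neq0 n_gt0)).
        congr (_ * _); move: (_ / C) => p.
        transitivity (p * (l.+1%:R * (n%:R * d0))); first by ring.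
        rewrite d0e0; transitivity (p * k%:R * (l.+1%:R * e0)); first by ring.
        by rewrite e0C; ring.
      by rewrite /y; ring.
    by rewrite ler_wpM2l ?(ltW K_gt0) // link_le_face_sum.
have main : face_sum D n.+1 x / C' <= rho ^+ n.+1.
  rewrite -(ler_pM2l l_gt0) -sum_d.
  apply: le_trans (ler_sum _ vertexP) _.
  (* The corrections rho^n - y v add up to (|S| - (l + 1)) rho^n <= 0. *)
  rewrite -big_distrr /= big_split /= -big_distrl /= sumrB sum_y sumr_const.
  rewrite exprS [leRHS]mulrCA ler_pM2l // gerDl pmulr_lle0 ?invr_gt0 //.
  by rewrite subr_le0 -[leLHS]mulr_natl ler_pM2r // ler_nat.
rewrite -rhon -exprM mulnC exprM lerXn2r // nnegrE ?exprn_ge0 ?(ltW rho_gt0) //.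
by rewrite divr_ge0 ?face_sum_ge0 // ltW.
Qed.

(** * Reduction to weights supported on a clique *)

Definition support x := [set v | x v != 0].

(* Motzkin-Straus symmetrization: no face contains both u and v, so face sums are
   affine in (x u, x v). *)
Lemma symmetrize D n x u v :
  down_closed D -> (forall w, 0 <= x w) ->
  x u != 0 -> x v != 0 -> u != v -> [set u; v] \notin D ->
  exists x', [/\ (forall w, 0 <= x' w), support x' \proper support x,
    face_sum D n.+1 x' = face_sum D n.+1 x &
    face_sum D n.+2 x <= face_sum D n.+2 x'].
Proof.
move=> Ddown x0 xu xv uv uvD.
(* Coefficients of the affine form; p is free of x v because the link of u misses v. *)
pose p m := face_sum (link D u) m x.
pose q m := face_sum (link (deletion D u) v) m x.
pose c m := face_sum (deletion (deletion D u) v) m x.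
pose x' a b w := if w == u then a else if w == v then b else x w.
have face_sumE a b m :
    face_sum D m.+1 (x' a b) = a * p m + b * q m + c m.+1.
  have agree D' : (forall A, A \in D' -> (u \notin A) && (v \notin A)) ->
      forall k, face_sum D' k (x' a b) = face_sum D' k x.
    move=> D'uv k; apply: eq_face_sum => A /D'uv/andP[uA vA] w wA.
    have wu : w != u by apply: contraNneq uA => <-.
    have wv : w != v by apply: contraNneq vA => <-.
    by rewrite /x' (negPf wu) (negPf wv).
  rewrite (face_sum_split D m _ u) (face_sum_split _ m _ v) addrA.
  rewrite !agree /x' ?eqxx 1?eq_sym ?(negPf uv) //.
  - by move=> A; rewrite !inE => /andP[/andP[_ ->] ->].
  - by move=> A; rewrite !inE => /and3P[-> _]; rewrite negb_or => /andP[_ ->].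
  - move=> A; rewrite !inE => /andP[-> uAD] /=.
    apply: contra uvD => vA; apply: Ddown uAD _.
    by rewrite setUS // sub1set.
have xE m : face_sum D m.+1 x = x u * p m + x v * q m + c m.+1.
  by rewrite (face_sum_split D m _ u) (face_sum_split _ m _ v) addrA.
have pp : p n = 0 -> p n.+1 = 0.
  by apply: face_sum_eq0S => //; apply: link_down_closed.
have qq : q n = 0 -> q n.+1 = 0.
  apply: face_sum_eq0S => //; apply: link_down_closed.
  exact: deletion_down_closed.
have p0 : 0 <= p n by apply: face_sum_ge0.
have q0 : 0 <= q n by apply: face_sum_ge0.
have [a [b [a0 b0 ab Pn Pn1]]] := two_point_shift (x0 u) (x0 v) p0 q0 pp qq.
exists (x' a b); split.
- by move=> w; rewrite /x'; case: ifP => // _; case: ifP.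
- apply/properP; split.
    apply/subsetP => w; rewrite !inE /x'.
    by case: (w =P u) => [->//|_]; case: (w =P v) => [->//|].
  case/orP: ab => /eqP E; [exists u|exists v]; rewrite ?inE ?xu ?xv //.
    by rewrite /x' eqxx E eqxx.
  by rewrite /x' [v == u]eq_sym (negPf uv) eqxx E eqxx.
- by rewrite face_sumE xE Pn.
- by rewrite face_sumE xE lerD2r.
Qed.

(** Induction on the size of the support: symmetrize an unjoined pair in it; if there is none, it is
    a clique, and faces leaving it contribute 0. *)
Lemma face_sum_clique_free n l D x : (n.+1 < l)%N ->
  down_closed D -> set0 \in D -> (forall v, 0 <= x v) ->
  (forall K : {set V},
    {in K &, forall u v, u != v -> [set u; v] \in D} -> (#|K| <= l)%N) ->
  (face_sum D n.+2 x / 'C(l, n.+2)%:R) ^+ n.+1 <=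
  (face_sum D n.+1 x / 'C(l, n.+1)%:R) ^+ n.+2.
Proof.
move=> nl Ddown D0 x0 Dl.
have [N le_N] := ubnP #|support x|.
elim: N x x0 le_N => // N IH x x0; rewrite ltnS => le_N.
have [clique|] := boolP [forall u in support x, forall v in support x,
    (u != v) ==> ([set u; v] \in D)].
  pose D' := [set A in D | A \subset support x].
  have D'E m : face_sum D m x = face_sum D' m x.
    rewrite /face_sum (bigID (fun A => A \subset support x)) /=.
    rewrite [X in _ + X]big1 ?addr0.
      by apply: eq_bigl => A; rewrite !inE andbAC.
    move=> A /andP[_ /subsetPn[v vA]]; rewrite inE negbK => /eqP xv.
    by rewrite (bigD1 v) //= xv mul0r.
  rewrite !D'E; apply: face_sum_bounded_support (support x) _ _ _ _ _ _ _ => //.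
  - move=> A B; rewrite !inE => /andP[BD Bs] AB.
    by rewrite (Ddown _ _ BD AB) (subset_trans AB).
  - by rewrite inE D0 sub0set.
  - by move=> A; rewrite inE => /andP[].
  - apply: Dl => u v uK vK uv.
    by have /forall_inP/(_ u uK)/forall_inP/(_ v vK)/implyP/(_ uv) := clique.
case/forall_inPn => u us /forall_inPn[v vs]; rewrite negb_imply => /andP[uv uvD].
move: us vs; rewrite !inE => xu xv.
have [x' [x'0 sx' Pn Pn1]] := symmetrize n Ddown x0 xu xv uv uvD.
apply: le_trans (_ : (face_sum D n.+2 x' / 'C(l, n.+2)%:R) ^+ n.+1 <= _).
  by rewrite lerXn2r ?nnegrE ?divr_ge0 ?face_sum_ge0 // ler_wpM2r ?invr_ge0.
rewrite -Pn; apply: IH => //.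
exact: leq_trans (proper_card sx') le_N.
Qed.

End Complexes.

(** * The complex of shadows of a hypergraph *)

Section Hypergraph.
Variables (r l : nat) (H : hgraph r).
Hypotheses (r_ge2 : (2 <= r)%N) (H_free : free_of (@Kfam r l.+1) H).
Local Notation V := (vertex H).

(* The empty set is added so that this is a nonempty complex even if H has no
   edge. *)
Definition shadow_complex : {set {set V}} := [set A : {set V} |
  (A == set0) ||
  (if (#|A| < r)%N then [exists B in edges H, A \subset B]
   else induces_complete A)].

Lemma induces_completeP (A : {set V}) : reflect
  (forall e : {set V}, e \subset A -> #|e| = r -> e \in edges H)
  (induces_complete A).
Proof.
apply: (iffP eqP) => [/setP E e eA cE|h].
  by have := E e; rewrite !inE eA cE eqxx andbT.
apply/setP => e; rewrite !inE andbC; case eA: (e \subset A) => //=.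
apply/idP/eqP => [|cE]; first exact: edges_card.
exact: h.
Qed.

Lemma shadow_complex_down_closed : down_closed shadow_complex.
Proof.
move=> A B; rewrite !inE => /orP[/eqP->|BD] AB.
  by move: AB; rewrite subset0 => ->.
have [//|A0] /= := eqVneq A set0.
move: BD; case: ltnP => cB.
  rewrite (leq_ltn_trans (subset_leq_card AB) cB).
  case/exists_inP=> e eH Be; apply/exists_inP; exists e => //.
  exact: subset_trans AB Be.
move/induces_completeP => Bc; case: ltnP => cA; last first.
  by apply/induces_completeP => e eA; apply: Bc; apply: subset_trans AB.
(* A small A inside a complete B extends within B to an r-set, which is an edge. *)
have [e [Ae eB ce]] : exists e : {set V}, [/\ A \subset e, e \subset B & #|e| = r].
  have [|T TBA cT] := @subset_of_card _ (B :\: A) (r - #|A|).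
    by rewrite cardsD (setIidPr AB) leq_sub2r.
  exists (A :|: T); rewrite subsetUl subUset AB.
  rewrite (subset_trans TBA (subsetDl _ _)); split=> //.
  rewrite cardsU disjoint_setI0 ?cards0 ?subn0 ?cT ?subnKC //; first exact: ltnW.
  by rewrite disjoint_sym disjoints_subset (subset_trans TBA) // setDE subsetIr.
apply/exists_inP; exists e => //.
exact: Bc.
Qed.

Lemma shadow_complex_edge (A : {set V}) : A \in shadow_complex ->
  (0 < #|A| <= r)%N -> exists2 e, e \in edges H & A \subset e.
Proof.
rewrite inE -cards_eq0 => /orP[/eqP->//|AD /andP[_]].
rewrite leq_eqVlt => /orP[/eqP cA|cA]; move: AD.
  by rewrite cA ltnn => /induces_completeP/(_ A (subxx _) cA); exists A.
by rewrite cA => /exists_inP.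
Qed.

(** In a clique on l + 1 vertices, choosing one edge over each pair gives at most 'C(l + 1, 2)
    edges, hence a forbidden subgraph. *)
Lemma shadow_complex_clique (K : {set V}) :
  {in K &, forall u v, u != v -> [set u; v] \in shadow_complex} ->
  (#|K| <= l)%N.
Proof.
move=> clique; rewrite leqNgt; apply/negP => /subset_of_card[S SK cS].
pose pairs := [set e : {set V} | e \subset S & #|e| == 2].
pose g (e : {set V}) := odflt set0 [pick B in edges H | e \subset B].
have gP u v : u \in S -> v \in S -> u != v ->
    g [set u; v] \in edges H /\ [set u; v] \subset g [set u; v].
  move=> uS vS uv; rewrite /g; case: pickP => [B /andP[]//|noB].
  have [||e eH uve] := @shadow_complex_edge [set u; v].
  - by apply: clique => //; apply: (subsetP SK).
  - by rewrite cards2 uv.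
  by have := noB e; rewrite eH uve.
have F_edge e : e \in g @: pairs -> e \in edges H.
  case/imsetP => p + ->; rewrite inE => /andP[pS /cards2P cp].
  case: cp pS => u [v [uv ->]]; rewrite subUset !sub1set => /andP[uS vS].
  by case: (gP u v uS vS uv).
have F_card e (eF : e \in g @: pairs) : #|e| = r := edges_card (F_edge e eF).
apply: (H_free (F := HGraph F_card)); last first.
  by exists id => //= e; rewrite imset_id; apply: F_edge.
split=> /=.
  by rewrite -cS -cards_draws leq_imset_card.
exists S => //= u v uS vS uv; have [gH guv] := gP u v uS vS uv.
exists (g [set u; v]) => //; apply: imset_f.
by rewrite inE cards2 uv subUset !sub1set uS vS.
Qed.

(** The index r - s is positive exactly when s < r, so the two case distinctions agree; s > 0 keeps
    out the added empty set. *)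
Lemma card_shadow (R : realType) s : (0 < s)%N ->
  #|shadow H (r%:Z - s%:Z)|%:R = face_sum shadow_complex s (fun=> 1 : R).
Proof.
move=> s_gt0; rewrite /face_sum.
under eq_bigr do rewrite big1 //.
rewrite sumr_const; congr _%:R; apply: eq_card => A; rewrite !inE.
have -> : (#|A|%:Z == r%:Z - (r%:Z - s%:Z)) = (#|A| == s) by lia.
rewrite [RHS]andbC; case: eqP => //= cA.
rewrite inE -cards_eq0 cA eqn0Ngt s_gt0 /=.
by have -> : (0 < r%:Z - s%:Z) = (s < r)%N by lia.
Qed.

End Hypergraph.

Theorem theorem1p17 (R : realType) (r l : nat) (hr : (2 <= r)%N)
  (hl : (r <= l)%N) (H : hgraph r) (hH : free_of (@Kfam r l.+1) H)
  (i : int) (hi1 : r%:Z - l%:Z <= i) (hi2 : i <= r%:Z - 2) :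
  (#|shadow H i|%:R / 'C(l, `|(r%:Z - i)%R|%N)%:R : R)
      `^ ((r%:Z - i)%:~R^-1)
  <= (#|shadow H (i + 1)|%:R / 'C(l, `|(r%:Z - i - 1)%R|%N)%:R : R)
      `^ ((r%:Z - i - 1)%:~R^-1).
Proof.
have [n iE] : exists n, i = r%:Z - n.+2%:Z.
  by exists `|(r%:Z - i - 2)%R|%N; lia.
have nl : (n.+1 < l)%N by lia.
have i1E : i + 1 = r%:Z - n.+1%:Z by lia.
have riE : r%:Z - i = n.+2%:Z by lia.
have ri1E : n.+2%:Z - 1 = n.+1%:Z :> int by lia.
rewrite i1E riE ri1E iE !card_shadow // !absz_nat -!pmulrn.
set a := _ / _; set b := _ / _.
have a_ge0 : 0 <= a by rewrite divr_ge0 ?face_sum_ge0.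
have b_ge0 : 0 <= b by rewrite divr_ge0 ?face_sum_ge0.
have ab : a ^+ n.+1 <= b ^+ n.+2.
  apply: face_sum_clique_free => //.
  - exact: shadow_complex_down_closed.
  - by rewrite inE eqxx.
  - exact: shadow_complex_clique.
(* This power clears both roots at once. *)
rewrite -(@ler_pXn2r _ (n.+2 * n.+1)) ?nnegrE ?powR_ge0 //.
by rewrite exprM powR_invnK // mulnC exprM powR_invnK.
Qed.
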